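(* Let $n,m,l$ be positive integers with $m<\min(n,l)$, and let $k,k'$ be the positive integers with $km<n\le (k+1)m$ and $k'm<l\le (k'+1)m$. Let $A\in\mathcal{T}(n,m)$, $A\ne0$, be $A=A(a,\alpha)+a_0I_{n\times m}$ and let $B\in\mathcal{T}(m,l)$, $B\neq0$, be $B=A(b,\beta)+b_0I_{m\times l}$, where $a=(0,a_1,\dots,a_{n-1})^T$, $\alpha=(0,\alpha_1,\dots,\alpha_{m-1})^T$, $b=(0,b_1,\dots,b_{m-1})^T$, $\beta=(0,\beta_1,\dots,\beta_{l-1})^T$. Then $AB\in\mathcal{T}(n,l)$ if and only if there is $\lambda\in\hat{\mathbb{C}}=\mathbb{C}\cup\{\infty\}$ such that $A$ has form $(\mathrm{a}_\lambda)$ and $B$ has form $(\mathrm{b}_\lambda)$, where these forms are as follows. For $\lambda\in\mathbb{C}\setminus\{0\}$: $(\mathrm{a}_\lambda)$: $A$ is the asymmetric Toeplitz matrix with first row $(a_0,\tfrac1\lambda a_{m-1},\tfrac1\lambda a_{m-2},\dots,\tfrac1\lambda a_1)$ and first column $(a_0,a_1,\dots,a_{m-1},\lambda a_0,\dots,\lambda a_{m-1},\dots,\lambda^k a_0,\dots,\lambda^k a_{n-km-1})^T$. $(\mathrm{b}_\lambda)$: $B$ is the asymmetric Toeplitz matrix with first column $(b_0,\lambda\overline{\beta}_{m-1},\dots,\lambda\overline{\beta}_1)^T$ and first row $(b_0,\overline{\beta}_1,\dots,\overline{\beta}_{m-1},\tfrac1\lambda b_0,\tfrac1\lambda\overline{\beta}_1,\dots,\tfrac1\lambda\overline{\beta}_{m-1},\dots,\tfrac1{\lambda^{k'}}b_0,\dots,\tfrac1{\lambda^{k'}}\overline{\beta}_{l-k'm-1})$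 (the last entry being $\tfrac{1}{\lambda^{k'}}b_0$ if $l=k'm+1$). For $\lambda=0$: $(\mathrm{a}_0)$: $A=A(0,\alpha)+a_0I_{n\times m}$, i.e. $a=0$. $(\mathrm{b}_0)$: $B$ has first column $0$ and first row $(0,\dots,0,\overline{\beta}_{l-m},\dots,\overline{\beta}_{l-1})$, i.e. $b_0=0$, $b=0$ and $\beta_j=0$ for $1\le j\le l-m-1$. For $\lambda=\infty$: $(\mathrm{a}_\infty)$: $A$ has first row $0$ and first column $(0,\dots,0,a_{n-m},\dots,a_{n-1})^T$, i.e. $a_0=0$, $\alpha=0$ and $a_i=0$ for $1\le i\le n-m-1$. $(\mathrm{b}_\infty)$: $B=A(b,0)+b_0I_{m\times l}$, i.e. $\beta=0$.
   Context: Matrices are complex; rows and columns of an $n\times m$ matrix are numbered $0,\dots,n-1$ and $0,\dots,m-1$. An asymmetric Toeplitz matrix is an $n\times m$ matrix constant along each diagonal (hence determined by its first row and first column); $\mathcal{T}(n,m)$ is the set of all of them. For $a=(0,a_1,\dots,a_{n-1})^T\in\mathbb{C}^n$ and $\alpha=(0,\alpha_1,\dots,\alpha_{m-1})^T\in\mathbb{C}^m$, $A(a,\alpha)$ is the $n\times m$ matrix whose $(i,j)$ entry is $a_{i-j}$ if $i>j$, $0$ if $i=j$, and $\overline{\alpha}_{j-i}$ if $i<j$. $I_{n\times m}$ is the $n\times m$ matrix with $(i,j)$ entry $1$ if $i=j$ and $0$ otherwise. Every $A\in\mathcal{T}(n,m)$ is uniquely $A=A(a,\alpha)+a_0I_{n\times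 m}$ with $a_0\in\mathbb{C}$. *)

(* Defs.v *)
From mathcomp Require Import all_boot all_order all_algebra.
From mathcomp Require Import reals complex.

Set Implicit Arguments.
Unset Strict Implicit.
Unset Printing Implicit Defensive.

Import Order.TTheory GRing.Theory Num.Theory.
Local Open Scope ring_scope.

(* The condition [i + j' = i' + j] says [i - j = i' - j'] in the integers. *)
Definition is_toeplitz (T : Type) (n m : nat) (A : 'M[T]_(n, m)) : Prop :=
  forall (i i' : 'I_n) (j j' : 'I_m), (i + j' = i' + j)%N -> A i j = A i' j'.

Section Forms.

Variable C : numClosedFieldType.

Definition is_toeplitz_with (n m : nat) (A : 'M[C]_(n, m)) (c r : seq C)
  : Prop :=
  [/\ is_toeplitz A,
      forall (i : 'I_n) (j : 'I_m), j = 0%N :> nat -> A i j = c`_i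
    & forall (i : 'I_n) (j : 'I_m), i = 0%N :> nat -> A i j = r`_j].

(* Out-of-range indices give 0, but none occurs in the uses below. *)
Definition entry (n : nat) (v : 'cV[C]_n) (k : nat) : C :=
  if insub k is Some i then v i ord0 else 0.

Definition toep (n m : nat) (a : 'cV[C]_n) (alpha : 'cV[C]_m)
  : 'M[C]_(n, m) :=
  \matrix_(i < n, j < m)
    if (j < i)%N then entry a (i - j)
    else if (i < j)%N then (entry alpha (j - i))^* else 0.

Definition id_rect (n m : nat) : 'M[C]_(n, m) :=
  \matrix_(i < n, j < m) (i == j :> nat)%:R.

(* The vectors have zeroth entry 0; the diagonal constant [x0] (the a_0 or b_0
   of the text) is kept apart and takes the place of index 0 here. *)
Definition coef (n : nat) (x0 : C) (v : 'cV[C]_n) (k : nat) : C :=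
  if k is 0%N then x0 else entry v k.

Section FormA.

Variables (n m k : nat) (a : 'cV[C]_n) (alpha : 'cV[C]_m) (a0 : C).

Definition form_a_nonzero (lambda : C) (A : 'M[C]_(n, m)) : Prop :=
  is_toeplitz_with A
    ([seq lambda ^+ q * coef a0 a r | q <- iota 0 k, r <- iota 0 m]
     ++ [seq lambda ^+ k * coef a0 a r | r <- iota 0 (n - k * m)])
    (a0 :: [seq lambda^-1 * entry a (m - j) | j <- iota 1 m.-1]).

Definition form_a_zero (A : 'M[C]_(n, m)) : Prop :=
  A = toep 0 alpha + a0 *: id_rect n m.

Definition form_a_infty (A : 'M[C]_(n, m)) : Prop :=
  is_toeplitz_with A
    (nseq (n - m) 0 ++ [seq entry a i | i <- iota (n - m) m])
    (nseq m 0).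

(* [None] is the point at infinity of the extended complex plane. *)
Definition form_a (lambda : option C) (A : 'M[C]_(n, m)) : Prop :=
  match lambda with
  | Some z => if z == 0 then form_a_zero A else form_a_nonzero z A
  | None => form_a_infty A
  end.

End FormA.

Section FormB.

Variables (m l k : nat) (b : 'cV[C]_m) (beta : 'cV[C]_l) (b0 : C).

Let betaC : 'cV[C]_l := map_mx Num.conj beta.

Definition form_b_nonzero (lambda : C) (B : 'M[C]_(m, l)) : Prop :=
  is_toeplitz_with B
    (b0 :: [seq lambda * entry betaC (m - i) | i <- iota 1 m.-1])
    ([seq lambda ^- q * coef b0 betaC r | q <- iota 0 k, r <- iota 0 m]
     ++ [seq lambda ^- k * coef b0 betaC r | r <- iota 0 (l - k * m)]).

Definition form_b_zero (B : 'M[C]_(m, l)) : Prop :=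
  is_toeplitz_with B
    (nseq m 0)
    (nseq (l - m) 0 ++ [seq entry betaC j | j <- iota (l - m) m]).

Definition form_b_infty (B : 'M[C]_(m, l)) : Prop :=
  B = toep b 0 + b0 *: id_rect m l.

Definition form_b (lambda : option C) (B : 'M[C]_(m, l)) : Prop :=
  match lambda with
  | Some z => if z == 0 then form_b_zero B else form_b_nonzero z B
  | None => form_b_infty B
  end.

End FormB.

End Forms.

(* Main.v *)
Require Import Defs.
From mathcomp Require Import all_boot all_order all_algebra.
From mathcomp Require Import reals complex.
From mathcomp Require Import zify.

(** Number the diagonals of a Toeplitz matrix [A] with [m] columns from the
    top right corner, so that [A i j = F (i + (m.-1 - j))] for a sequence [F],
    called the symbol of [A] below; let [G] be the symbol of the transpose of
    [B].  Then the entries of the product are the window sums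
    [S i j = \sum_(r < m) F (i + r) * G (j + r)], and telescoping gives
    [S i.+1 j.+1 - S i j = F (i + m) * G (j + m) - F i * G j].  Hence [A *m B]
    is Toeplitz if and only if [F (s + m) * G (t + m) = F s * G t] for all
    [s < n.-1] and [t < l.-1] ([mulmx_toeplitzP]).

    This is an equality between two matrices of rank at most one.  Since
    [m < n], the vectors [F s] and [F (s + m)] together cover all diagonals of
    the nonzero matrix [A], so they do not both vanish, and likewise for [G].  Therefore the two pairs of
    vectors are proportional, with inverse ratios: either there is a scalar [z]
    such that [F (s + m) = z * F s] and [G t = z * G (t + m)], or [F s = 0] and
    [G (t + m) = 0] for all [s] and [t] ([rank1_eqP]).

    Finally, the forms of [A] say exactly that [F (s + m) = z * F s], or that
    [F s = 0] when the parameter is infinite ([form_aP]); the forms of [B] are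
    the forms of its transpose for the inverse parameter ([form_bP]). *)

Set Implicit Arguments.
Unset Strict Implicit.
Unset Printing Implicit Defensive.

Import Order.TTheory GRing.Theory Num.Theory.
Local Open Scope ring_scope.

(** * Products of Toeplitz matrices *)

Section Product.

Variables (C : comNzRingType) (n m l : nat) (F G : nat -> C).
Variables (A : 'M[C]_(n, m)) (B : 'M[C]_(m, l)).
Hypothesis AE : forall i j, A i j = F (i + (m.-1 - j)).
Hypothesis BE : forall j i, B j i = G (i + (m.-1 - j)).

(** The window sums of length [m]; see [mulmx_window]. *)
Let S (i j : nat) : C := \sum_(r < m) F (i + r) * G (j + r).

Lemma mulmx_window i j : (A *m B) i j = S i j.
Proof.
(* The diagonal number decreases with the summation index of the product. *)
rewrite mxE /S (reindex_inj rev_ord_inj) /=; apply: eq_bigr => r _.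
rewrite AE BE /=.
by have -> : (m.-1 - (m - r.+1) = r)%N by have := ltn_ord r; lia.
Qed.

(** Both sides are the window sum of length [m.+1], with its first and its last
    term split off. *)
Lemma window_succ i j : S i.+1 j.+1 + F i * G j = S i j + F (i + m) * G (j + m).
Proof.
rewrite /S.
transitivity (\sum_(r < m.+1) F (i + r) * G (j + r)).
  rewrite big_ord_recl addrC !addn0; congr (_ + _).
  by apply: eq_bigr => r _; rewrite /= /bump /= !addnA !addn1 !addSn.
by rewrite big_ord_recr.
Qed.

Lemma mulmx_toeplitzP : is_toeplitz (A *m B) <->
  forall s t, (s < n.-1)%N -> (t < l.-1)%N ->
    F (s + m) * G (t + m) = F s * G t.
Proof.
split=> [AB s t ltsn lttl | FG].
  have lts : (s < n)%N by lia.
  have ltS : (s.+1 < n)%N by lia.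
  have ltt : (t < l)%N by lia.
  have ltT : (t.+1 < l)%N by lia.
  have := AB (Ordinal ltS) (Ordinal lts) (Ordinal ltT) (Ordinal ltt).
  rewrite !mulmx_window /= addnS addSn => /(_ erefl) eqS.
  by have := window_succ s t; rewrite eqS => /addrI ->.
(* Conversely, the window sums are constant along diagonals. *)
have shift d : forall i j, (i + d < n)%N -> (j + d < l)%N ->
    S (i + d) (j + d) = S i j.
  elim: d => [|d IHd] i j lti ltj; first by rewrite !addn0.
  rewrite !addnS -(IHd i j) ; try lia.
  have := window_succ (i + d) (j + d).
  by rewrite FG; try lia; move/addIr.
move=> i i' j j' eqd; rewrite !mulmx_window.
have [lti lti' ltj ltj'] :
  [/\ i < n, i' < n, j < l & j' < l]%N by rewrite !ltn_ord.
have [le_ii'|lt_i'i] := leqP i i'.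
  have -> : (i' : nat) = (i + (i' - i))%N by lia.
  have -> : (j' : nat) = (j + (i' - i))%N by lia.
  by rewrite shift //; lia.
have -> : (i : nat) = (i' + (i - i'))%N by lia.
have -> : (j : nat) = (j' + (i - i'))%N by lia.
by rewrite shift //; lia.
Qed.

End Product.

(** If neither the pair [u], [v] nor the pair [x], [y] vanishes identically,
    then [u x^T = v y^T] means that [u] is to [v] as [y] is to [x]; the second
    alternative is the infinite ratio. *)
Lemma rank1_eqP (C : fieldType) (N L : nat) (u v x y : nat -> C) :
  ~ (forall s, (s < N)%N -> u s = 0 /\ v s = 0) ->
  ~ (forall t, (t < L)%N -> x t = 0 /\ y t = 0) ->
  (forall s t, (s < N)%N -> (t < L)%N -> u s * x t = v s * y t) <->
  (exists z, (forall s, (s < N)%N -> u s = z * v s) /\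
             (forall t, (t < L)%N -> y t = z * x t)) \/
  ((forall s, (s < N)%N -> v s = 0) /\ (forall t, (t < L)%N -> x t = 0)).
Proof.
move=> uv_n0 xy_n0; split; last first.
  move=> [[z [uE yE]] | [v0 x0]] s t lts ltt.
    by rewrite uE // yE // mulrCA mulrA.
  by rewrite v0 // x0 // mulr0 mul0r.
move=> eq1.
have [/existsP[/= s0 vs0] | v_0] := boolP [exists s : 'I_N, v s != 0]; last first.
  have v0 s (lts : (s < N)%N) : v s = 0.
    by apply/eqP; move/existsPn: v_0 => /(_ (Ordinal lts)); rewrite negbK.
  have [/existsP[/= s1 us1] | u_0] := boolP [exists s : 'I_N, u s != 0].
    right; split=> // t ltt; apply/eqP.
    have /eqP := eq1 s1 t (ltn_ord _) ltt.
    by rewrite (v0 s1) // mul0r mulf_eq0 (negPf us1).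
  case: uv_n0 => s lts; split; last exact: v0.
  by apply/eqP; move/existsPn: u_0 => /(_ (Ordinal lts)); rewrite negbK.
(* The ratio is read off any index where [v] does not vanish. *)
left; exists (u s0 / v s0).
have yE t (ltt : (t < L)%N) : y t = u s0 / v s0 * x t.
  by apply: (mulfI vs0); rewrite -eq1 // mulrA mulrCA divff // mulr1.
split=> // s lts.
have [/existsP[/= t0 xt0] | x_0] := boolP [exists t : 'I_L, x t != 0].
  by apply: (mulIf xt0); rewrite eq1 // yE // mulrA [v s * _]mulrC.
case: xy_n0 => t ltt.
have x0 : x t = 0.
  by apply/eqP; move/existsPn: x_0 => /(_ (Ordinal ltt)); rewrite negbK.
by rewrite yE // x0 mulr0.
Qed.

(** * The forms in terms of symbols *)

(** A double list over quotients and remainders by [m], with an incomplete last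
    block, lists the values at [i %/ m] and [i %% m] for [i < n]. *)
Lemma blocks_mkseq (T : Type) (f : nat -> nat -> T) (k m n : nat) :
  (0 < m)%N -> (k * m <= n <= (k + 1) * m)%N ->
  [seq f q r | q <- iota 0 k, r <- iota 0 m] ++
    [seq f k r | r <- iota 0 (n - k * m)] =
  mkseq (fun i => f (i %/ m)%N (i %% m)%N) n.
Proof.
move=> m_gt0.
have blockE q p : (p <= m)%N -> [seq f q r | r <- iota 0 p] =
    [seq f (i %/ m)%N (i %% m)%N | i <- iota (q * m) p].
  move=> lepm; rewrite -[(q * m)%N]addn0 iotaDl -map_comp.
  apply/eq_in_map => r; rewrite mem_iota add0n => /andP[_ ltr] /=.
  have ltrm := leq_trans ltr lepm.
  by rewrite divnMDl // divn_small // addn0 modnMDl modn_small.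
elim: k n => [|k IHk] n /andP[len gen].
  rewrite mul0n subn0 /= blockE; last lia.
  by rewrite mul0n.
have splitk : [seq f q r | q <- iota 0 k.+1, r <- iota 0 m] =
    [seq f q r | q <- iota 0 k, r <- iota 0 m] ++ [seq f k r | r <- iota 0 m].
  by rewrite -addn1 iotaD allpairs_cat /= cats0.
rewrite splitk.
have -> : [seq f k r | r <- iota 0 m] =
    [seq f k r | r <- iota 0 (k.+1 * m - k * m)] by rewrite mulSn addnK.
rewrite IHk; last by rewrite addn1 leqnn mulSn leq_addl.
rewrite blockE; last by move: gen; rewrite addn1 mulSn; lia.
by rewrite /mkseq -map_cat -[X in iota X (n - _)]add0n -iotaD subnKC.
Qed.

Section Symbol.

Variable C : numClosedFieldType.
Implicit Types (n m : nat).

(** The values of the Toeplitz matrix [toep a alpha + a0 *: id_rect _ n m] on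
    its diagonals, numbered from the top right corner; the main diagonal has
    number [m.-1]. *)
Definition symbol n m (a : 'cV[C]_n) (alpha : 'cV[C]_m) (a0 : C) (t : nat)
  : C :=
  if (t < m.-1)%N then (entry alpha (m.-1 - t))^* else coef a0 a (t - m.-1).

Lemma toepE n m (a : 'cV[C]_n) (alpha : 'cV[C]_m) a0 (i : 'I_n) (j : 'I_m) :
  (toep a alpha + a0 *: id_rect C n m) i j
  = symbol a alpha a0 (i + (m.-1 - j)).
Proof.
have ltj := ltn_ord j; rewrite !mxE /symbol.
case: (ltngtP i j) => [lt_ij|lt_ji|eq_ij].
- rewrite mulr0 addr0 ifT; last lia.
  by congr (entry _ _)^*; lia.
- rewrite mulr0 addr0 ifF; last lia.
  have -> : (i + (m.-1 - j) - m.-1 = i - j)%N by lia.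
  by move: lt_ji; rewrite -subn_gt0; case: (i - j)%N.
- rewrite add0r mulr1 ifF; last lia.
  by have -> : (i + (m.-1 - j) - m.-1 = 0)%N by lia.
Qed.

Lemma entryE n (v : 'cV[C]_n) (i : 'I_n) : entry v i = v i ord0.
Proof. by rewrite /entry valK. Qed.

Lemma entry0 n s : entry (0 : 'cV[C]_n) s = 0.
Proof. by rewrite /entry; case: insub => // i; rewrite mxE. Qed.

Lemma entry_conj n (v : 'cV[C]_n) s :
  entry (map_mx Num.conj v) s = (entry v s)^*.
Proof.
by rewrite /entry; case: insub => [i|]; rewrite ?mxE // conjC0.
Qed.

Lemma map_conjK n (v : 'cV[C]_n) : map_mx Num.conj (map_mx Num.conj v) = v.
Proof. by apply/matrixP => i j; rewrite !mxE conjCK. Qed.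

Lemma tr_toep n m (a : 'cV[C]_n) (alpha : 'cV[C]_m) a0 :
  (toep a alpha + a0 *: id_rect C n m)^T =
  toep (map_mx Num.conj alpha) (map_mx Num.conj a) + a0 *: id_rect C m n.
Proof.
apply/matrixP => i j; rewrite !mxE !entry_conj conjCK eq_sym.
by case: ltngtP.
Qed.

Lemma is_toeplitz_with_tr n m (A : 'M[C]_(n, m)) c r :
  is_toeplitz_with A c r <-> is_toeplitz_with A^T r c.
Proof.
have trT n' m' (M : 'M[C]_(n', m')) : is_toeplitz M -> is_toeplitz M^T.
  by move=> MT i i' j j' e; rewrite !mxE; apply: MT; lia.
split=> [] [AT Ac Ar]; split.
- exact: trT.
- by move=> i j; rewrite mxE; apply: Ar.
- by move=> i j; rewrite mxE; apply: Ac.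
- by rewrite -[A]trmxK; apply: trT.
- by move=> i j /(Ar j i); rewrite mxE.
- by move=> i j /(Ac j i); rewrite mxE.
Qed.

Section Forms.

Variables (n m k : nat) (a : 'cV[C]_n) (alpha : 'cV[C]_m) (a0 : C).
Variable A : 'M[C]_(n, m).
Hypotheses (m_gt0 : (0 < m)%N) (lt_mn : (m < n)%N).
Hypothesis AE : A = toep a alpha + a0 *: id_rect C n m.

Local Notation F := (symbol a alpha a0).

Let AF i j : A i j = F (i + (m.-1 - j)).
Proof. by rewrite AE toepE. Qed.

Lemma toep_is_toeplitz : is_toeplitz A.
Proof.
move=> i i' j j' e; rewrite !AF; congr (F _).
by have := ltn_ord j; have := ltn_ord j'; lia.
Qed.

Lemma symbolS s : F (s + m) = entry a s.+1.
Proof.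
rewrite /symbol ifF; last lia.
by have -> : (s + m - m.-1 = s.+1)%N by lia.
Qed.

Lemma symbol_col s : F (s + m.-1) = coef a0 a s.
Proof. by rewrite /symbol ifF ?addnK //; lia. Qed.

Lemma toep_colE (i : 'I_n) (j : 'I_m) : j = 0%N :> nat -> A i j = coef a0 a i.
Proof. by move=> j0; rewrite AF j0 subn0 symbol_col. Qed.

Lemma toep_rowE (i : 'I_n) (j : 'I_m) : i = 0%N :> nat -> A i j = F (m.-1 - j).
Proof. by move=> i0; rewrite AF i0. Qed.

(** As [m < n], the diagonals numbered [s] or [s + m] with [s < n.-1] are all
    the diagonals of [A]. *)
Lemma symbol_neq0 :
  A <> 0 -> ~ (forall s, (s < n.-1)%N -> F s = 0 /\ F (s + m) = 0).
Proof.
move=> A_n0 F0; apply: A_n0; apply/matrixP => i j; rewrite AF mxE.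
have lti := ltn_ord i; have ltj := ltn_ord j.
have [lt|ge] := ltnP (i + (m.-1 - j)) n.-1; first by have [] := F0 _ lt.
have [|_] := F0 (i + (m.-1 - j) - m)%N; first lia.
by rewrite subnK //; lia.
Qed.

Lemma form_a_zeroP : entry a 0 = 0 ->
  form_a_zero alpha a0 A <-> forall s, (s < n.-1)%N -> F (s + m) = 0.
Proof.
move=> ea0; split=> [A0 s lts | F0].
  have ltS : (s.+1 < n)%N by lia.
  transitivity (A (Ordinal ltS) (Ordinal m_gt0)).
    by rewrite toep_colE // symbolS.
  by rewrite A0 toepE subn0 /symbol /= ifF ?addnK /= ?entry0 //; lia.
rewrite /form_a_zero AE; congr (toep _ _ + _).
apply/colP => i; rewrite mxE -entryE.
case: i => -[|s] lts //=.
by rewrite -symbolS F0 //; lia.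
Qed.

Lemma form_a_inftyP :
  form_a_infty a A <-> forall s, (s < n.-1)%N -> F s = 0.
Proof.
have n_gt0 : (0 < n)%N by lia.
split=> [[_ Ac Ar] s lts | F0].
  have [lt_s|ge_s] := ltnP s m.
    have ltj : (m.-1 - s < m)%N by lia.
    have := Ar (Ordinal n_gt0) (Ordinal ltj) erefl.
    rewrite toep_rowE //= nth_nseq ltj.
    by have -> : (m.-1 - (m.-1 - s) = s)%N by lia.
  have lti : (s - m.-1 < n)%N by lia.
  have := Ac (Ordinal lti) (Ordinal m_gt0) erefl.
  rewrite toep_colE //= nth_cat size_nseq ifT; last lia.
  rewrite nth_nseq ifT; last lia.
  by rewrite -symbol_col subnK //; lia.
split; first exact: toep_is_toeplitz.
  move=> i j j0; have lti := ltn_ord i.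
  rewrite toep_colE // nth_cat size_nseq; case: ifP => [lt_i|ge_i].
    by rewrite nth_nseq lt_i -symbol_col F0 //; lia.
  have lt_im : (i - (n - m) < m)%N by lia.
  rewrite (nth_map 0%N) ?size_iota // nth_iota // subnKC; last lia.
  by case: (i : nat) ge_i => //; lia.
move=> i j i0; rewrite toep_rowE // nth_nseq if_same F0 //.
by have := ltn_ord j; lia.
Qed.

Lemma form_a_nonzeroP (z : C) : z != 0 -> (k * m <= n <= (k + 1) * m)%N ->
  form_a_nonzero k a a0 z A <-> forall s, (s < n.-1)%N -> F (s + m) = z * F s.
Proof.
move=> z_n0 kmn; rewrite /form_a_nonzero.
rewrite (blocks_mkseq (fun q r => z ^+ q * coef a0 a r) m_gt0 kmn).
have n_gt0 : (0 < n)%N by lia.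
have rowE j : (0 < j < m)%N ->
    (a0 :: [seq z^-1 * entry a (m - r) | r <- iota 1 m.-1])`_j =
    z^-1 * F (m.-1 - j + m).
  case: j => // j ltj /=; rewrite (nth_map 0%N) ?size_iota; last lia.
  rewrite nth_iota; last lia.
  by rewrite symbolS; congr (_ * entry _ _); lia.
split=> [[_ Ac Ar] s lts | Fz].
  (* The first row gives the diagonals above the main one, and the first
     column the others. *)
  have [lt_s|ge_s] := ltnP s m.-1.
    have ltj : (m.-1 - s < m)%N by lia.
    have := Ar (Ordinal n_gt0) (Ordinal ltj) erefl.
    rewrite toep_rowE // rowE /=; last lia.
    have -> : (m.-1 - (m.-1 - s) = s)%N by lia.
    by move=> ->; rewrite mulVKf.
  have colE i : (i < n)%N -> F (i + m.-1) = z ^+ (i %/ m) * coef a0 a (i %% m).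
    move=> lti; have := Ac (Ordinal lti) (Ordinal m_gt0) erefl.
    by rewrite toep_colE // symbol_col => ->; rewrite nth_mkseq.
  have -> : (s + m = (s - m.-1 + m) + m.-1)%N by lia.
  rewrite colE; last lia.
  rewrite divnDr ?dvdnn // divnn m_gt0 addn1 exprS modnDr -mulrA -colE; last lia.
  by rewrite subnK.
have periodic q r : (q * m + r < n)%N ->
    F (q * m + r + m.-1) = z ^+ q * F (r + m.-1).
  elim: q => [|q IHq] ltq; first by rewrite mul1r.
  have -> : (q.+1 * m + r + m.-1 = q * m + r + m.-1 + m)%N by rewrite mulSn; lia.
  rewrite mulSn in ltq.
  by rewrite Fz ?IHq ?exprS ?mulrA //; lia.
split; first exact: toep_is_toeplitz.
  move=> i j j0; rewrite toep_colE // nth_mkseq // -!symbol_col.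
  by rewrite -periodic -divn_eq.
move=> i j i0; rewrite toep_rowE //; have ltj := ltn_ord j.
have [j0|j_gt0] := posnP j.
  by rewrite j0 subn0 -[m.-1]add0n symbol_col.
by rewrite rowE ?j_gt0 // Fz ?mulKf //; lia.
Qed.

(** The equation [F (s + m) = z * F s] also covers [z = 0]. *)
Lemma form_aP (lambda : option C) :
  entry a 0 = 0 -> (k * m <= n <= (k + 1) * m)%N ->
  form_a k a alpha a0 lambda A <->
  if lambda is Some z then forall s, (s < n.-1)%N -> F (s + m) = z * F s
  else forall s, (s < n.-1)%N -> F s = 0.
Proof.
move=> ea0 kmn; case: lambda => [z|] /=; last exact: form_a_inftyP.
case: eqVneq => [->|z_n0]; last exact: form_a_nonzeroP.
by rewrite form_a_zeroP //; split=> F0 s /F0 ->; rewrite mul0r.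
Qed.

End Forms.

(** Inversion of the extended complex plane. *)
Definition ext_inv (lambda : option C) : option C :=
  if lambda is Some z then if z == 0 then None else Some z^-1 else Some 0.

Section FormB.

Variables (m l k : nat) (b : 'cV[C]_m) (beta : 'cV[C]_l) (b0 : C).
Variable B : 'M[C]_(m, l).

(** Transposition conjugates the two vectors of parameters and exchanges rows
    and columns, which turns the forms of [B] into the forms of its transpose
    for the inverse parameter. *)
Lemma form_b_tr (lambda : option C) :
  form_b k b beta b0 lambda B <->
  form_a k (map_mx Num.conj beta) (map_mx Num.conj b) b0 (ext_inv lambda) B^T.
Proof.
case: lambda => [z|] /=; last first.
  rewrite eqxx /form_b_infty /form_a_zero; split=> [->|BT].
    by rewrite tr_toep map_mx0.
  by rewrite -[B]trmxK BT tr_toep map_mx0 map_conjK.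
case: eqVneq => [z0|z_n0]; first exact: is_toeplitz_with_tr.
rewrite /= invr_eq0 (negPf z_n0) /form_b_nonzero /form_a_nonzero invrK.
rewrite is_toeplitz_with_tr exprVn.
suff -> : [seq z^-1 ^+ q * coef b0 (map_mx Num.conj beta) r
             | q <- iota 0 k, r <- iota 0 m] =
          [seq z ^- q * coef b0 (map_mx Num.conj beta) r
             | q <- iota 0 k, r <- iota 0 m] by [].
by apply: eq_allpairs => q r; rewrite exprVn.
Qed.

Hypotheses (m_gt0 : (0 < m)%N) (lt_ml : (m < l)%N).
Hypothesis BE : B = toep b beta + b0 *: id_rect C m l.

Local Notation G := (symbol (map_mx Num.conj beta) (map_mx Num.conj b) b0).

Lemma form_bP (lambda : option C) :
  entry beta 0 = 0 -> (k * m <= l <= (k + 1) * m)%N ->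
  form_b k b beta b0 lambda B <->
  if lambda is Some z then forall t, (t < l.-1)%N -> G t = z * G (t + m)
  else forall t, (t < l.-1)%N -> G (t + m) = 0.
Proof.
move=> eb0 kml; rewrite form_b_tr form_aP //; first last.
- by rewrite entry_conj eb0 conjC0.
- by rewrite BE tr_toep.
case: lambda => [z|] /=; last by split=> G0 t /G0 ->; rewrite mul0r.
case: eqVneq => [->|z_n0] /=; first by split=> G0 t /G0 ->; rewrite mul0r.
by split=> Gz t /Gz ->; rewrite ?mulVKf ?mulKf.
Qed.

End FormB.

End Symbol.

(** * Toeplitz products of asymmetric Toeplitz matrices *)

Unset Implicit Arguments.

Theorem theorem3p4 (R : realType) (n m l k k' : nat)
    (A : 'M[R[i]]_(n, m)) (B : 'M[R[i]]_(m, l))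
    (a : 'cV[R[i]]_n) (alpha : 'cV[R[i]]_m) (a0 : R[i])
    (b : 'cV[R[i]]_m) (beta : 'cV[R[i]]_l) (b0 : R[i]) :
  (0 < n)%N -> (0 < m)%N -> (0 < l)%N -> (m < minn n l)%N ->
  (0 < k)%N -> (k * m < n <= (k + 1) * m)%N ->
  (0 < k')%N -> (k' * m < l <= (k' + 1) * m)%N ->
  entry a 0 = 0 -> entry alpha 0 = 0 ->
  entry b 0 = 0 -> entry beta 0 = 0 ->
  is_toeplitz A -> A <> 0 -> A = toep a alpha + a0 *: id_rect _ n m ->
  is_toeplitz B -> B <> 0 -> B = toep b beta + b0 *: id_rect _ m l ->
  is_toeplitz (A *m B) <->
  exists lambda : option R[i],
    form_a k a alpha a0 lambda A /\ form_b k' b beta b0 lambda B.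
Proof.
move=> _ m_gt0 _; rewrite leq_min => /andP[lt_mn lt_ml].
move=> _ /andP[lt_kn le_nk] _ /andP[lt_kl le_lk] ea0 _ _ eb0.
move=> _ A_n0 AE _ B_n0 BE.
have kmn : (k * m <= n <= (k + 1) * m)%N by rewrite ltnW.
have kml : (k' * m <= l <= (k' + 1) * m)%N by rewrite ltnW.
have BtE : B^T = toep (map_mx Num.conj beta) (map_mx Num.conj b)
                 + b0 *: id_rect _ l m by rewrite BE tr_toep.
have Bt_n0 : B^T <> 0 by move=> B0; apply: B_n0; rewrite -[B]trmxK B0 trmx0.
have formA lambda := form_aP m_gt0 lt_mn AE lambda ea0 kmn.
have formB lambda := form_bP m_gt0 lt_ml BE lambda eb0 kml.
have F_n0 := symbol_neq0 m_gt0 lt_mn AE A_n0.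
have G_n0 := symbol_neq0 m_gt0 lt_ml BtE Bt_n0.
set F := symbol a alpha a0 in formA F_n0.
set G := symbol _ _ b0 in formB G_n0.
have AF i j : A i j = F (i + (m.-1 - j))%N by rewrite AE toepE.
have BG j i : B j i = G (i + (m.-1 - j))%N by rewrite -[B]trmxK mxE BtE toepE.
rewrite (mulmx_toeplitzP AF BG).
rewrite (@rank1_eqP _ n.-1 l.-1 (fun s => F (s + m)%N) F
           (fun t => G (t + m)%N) G).
- split=> [[[z [Fz Gz]] | [F0 G0]] | [[z|] [/(formA _) Fz /(formB _) Gz]]].
  + by exists (Some z); split; [apply/formA | apply/formB].
  + by exists None; split; [apply/formA | apply/formB].
  + by left; exists z.
  + by right.
- by move=> FF; apply: F_n0 => s /FF[].
- by move=> GG; apply: G_n0 => s /GG[].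
Qed.
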